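(* Let $M$ be a matroid of rank $r$ on $n$ elements, and suppose that every cocircuit of $M$ has at least $r+1$ elements. Then \[ T(M;2,0) + T(M;0,2) \geq 2\,T(M;1,1). \]
   Context: For a matroid $M$ on ground set $E$ with rank function $\rho$, the Tutte polynomial is $T(M;x,y) = \sum_{A \subseteq E} (x-1)^{\rho(E)-\rho(A)} (y-1)^{|A|-\rho(A)}$. A cocircuit is the complement in $E$ of a flat of rank $r-1$ (a hyperplane). *)

(* Defs.v *)
From HB Require Import structures.
From mathcomp Require Import all_boot all_order all_algebra.

Set Implicit Arguments.
Unset Strict Implicit.
Unset Printing Implicit Defensive.

Import GRing.Theory.
Local Open Scope ring_scope.

(* A matroid whose ground set is the whole finite type E. *)
Record matroid (E : finType) := Matroid {
  rk : {set E} -> nat;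
  rk_le_card : forall A : {set E}, (rk A <= #|A|)%N;
  rk_mono : forall A B : {set E}, A \subset B -> (rk A <= rk B)%N;
  rk_submod : forall A B : {set E},
    (rk (A :|: B) + rk (A :&: B) <= rk A + rk B)%N
}.

Section MatroidNotions.
Variables (E : finType) (M : matroid E).

Definition rank : nat := rk M [set: E].

Definition flat (F : {set E}) : bool :=
  [forall e, (e \notin F) ==> (rk M F < rk M (e |: F))%N].

(* The rank condition avoids truncated subtraction: a matroid of rank 0 has no
   hyperplanes, hence no cocircuits. *)
Definition hyperplane (H : {set E}) : bool :=
  flat H && ((rk M H).+1 == rank).

Definition cocircuit (C : {set E}) : bool := hyperplane (~: C).

(* The outer variable 'X is x and the inner one 'Y = 'X%:P is y, so that
   T(M; a, b) is (tutte M).[a, b] = (tutte M).[a%:P].[b].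
   Both exponents are nonnegative by rk_mono and rk_le_card. *)
Definition tutte : {poly {poly int}} :=
  \sum_(A : {set E})
     ('X - 1) ^+ (rank - rk M A) * ('Y - 1) ^+ (#|A| - rk M A).

End MatroidNotions.

(* Main.v *)
Require Import Defs.
From mathcomp Require Import all_boot all_order all_algebra.
From mathcomp Require Import zify_ssreflect.

Set Implicit Arguments.
Unset Strict Implicit.
Unset Printing Implicit Defensive.

Import Order.TTheory GRing.Theory Num.Theory.
Local Open Scope ring_scope.

(** The difference of the two sides is a sum over the subsets A of E, to which
    only those with |A| = r mod 2 contribute. Bounding every nonspanning term
    from below by -2 leaves an expression that is nonincreasing in the number of
    nonspanning k-sets, for each k. As every cocircuit has at least r+1 elements,
    at least 2r - j elements raise the rank of a set of rank j < r, so building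
    a k-set one element at a time shows that M has at most as many nonspanning
    k-sets as the matroid consisting of U_(r,2r) on a 2r-set R together with
    loops. For that matroid, whose nonspanning sets A are those with
    |A :&: R| < r, taking symmetric differences with R gives the inequality. *)

(** * Counting supersets of a given size *)

Section Extensions.
Local Open Scope nat_scope.
Variable E : finType.
Implicit Types (A : {set E}) (P : pred {set E}).

Definition extensions P A p : {set {set E}} :=
  [set A' : {set E} | [&& A \subset A', #|A'| == #|A| + p & P A']].

Lemma card_extensions0 P A : #|extensions P A 0| = P A.
Proof.
have [PA|nPA] := boolP (P A).
- rewrite (_ : extensions P A 0 = [set A]) ?cards1 //.
  apply/setP=> A'; rewrite !inE addn0; apply/and3P/eqP => [[sAA' /eqP cA' _]|->].
    by apply/eqP; rewrite eq_sym eqEcard sAA' cA' leqnn.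
  by split.
- apply/eqP; rewrite cards_eq0; apply/eqP/setP=> A'; rewrite !inE addn0.
  apply: contraNF nPA => /and3P[sAA' /eqP cA' PA'].
  suff -> : A = A' by [].
  by apply/eqP; rewrite eqEcard sAA' cA' leqnn.
Qed.

(** Double counting of the pairs [(A', x)] with [x] in [A' :\: A]: each [A'] occurs with [p.+1]
    elements [x]. *)
Lemma card_extensionsS P A p :
  p.+1 * #|extensions P A p.+1| =
  \sum_(x in ~: A) #|extensions P (x |: A) p|.
Proof.
under eq_bigr => x _ do rewrite -sum1_card big_mkcond /=.
rewrite exchange_big /= -sum1_card big_distrr /= big_mkcond /=.
apply: eq_bigr => A' _; rewrite -big_mkcondr /=.
case: ifP => [|nA'].
- rewrite inE => /and3P[sAA' /eqP cA' PA'].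
  rewrite sum1_card muln1 (_ : p.+1 = #|A' :\: A|); last by rewrite cardsDS // cA' addKn.
  apply: eq_card => x; rewrite [RHS]unfold_in /= !inE.
  have [xA|xA] /= := boolP (x \in A); first by rewrite ?andbF.
  rewrite subUset sub1set sAA' PA' cardsU1 xA andbT cA'.
  by rewrite -addSnnS eqxx !andbT.
- rewrite big_pred0 // => x; rewrite !inE.
  apply/negbTE/negP => /andP[xA /and3P[]].
  rewrite subUset => /andP[_ sAA'] /eqP cA' PA'.
  move: nA'; rewrite inE sAA' PA' cA' cardsU1 xA andbT /=; lia.
Qed.

Lemma leq_sum_pairwise (X Y : {set E}) (g h : E -> nat) :
  #|X| = #|Y| -> (forall x y, x \in X -> y \in Y -> g x <= h y) ->
  \sum_(x in X) g x <= \sum_(y in Y) h y.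
Proof.
move=> cXY le_gh.
apply: (@leq_trans (#|X| * \max_(x in X) g x)).
  by rewrite -sum_nat_const; apply: leq_sum => x xX; apply: leq_bigmax_cond.
rewrite cXY -sum_nat_const; apply: leq_sum => y yY.
by apply/bigmax_leqP => x xX; apply: le_gh.
Qed.

Lemma exists_subset_card A k : k <= #|A| -> exists2 B : {set E}, B \subset A & #|B| = k.
Proof.
move=> lekA; exists [set x in take k (enum A)].
  by apply/subsetP=> x; rewrite inE => /mem_take; rewrite mem_enum.
rewrite cardsE (card_uniqP _) ?take_uniq ?enum_uniq //.
by rewrite size_takel // -cardE.
Qed.

(** Some subset of [X1] as large as [Y1] is compared with [Y1], and what is left of [X] with
    [Y :\: Y1]. *)
Lemma leq_sum_pairwise2 (X X1 Y Y1 : {set E}) (g h : E -> nat) :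
  X1 \subset X -> Y1 \subset Y -> #|X| = #|Y| -> #|Y1| <= #|X1| ->
  (forall x y, x \in X1 -> y \in Y -> g x <= h y) ->
  (forall x y, x \in X -> y \in Y :\: Y1 -> g x <= h y) ->
  \sum_(x in X) g x <= \sum_(y in Y) h y.
Proof.
move=> sX sY cXY /exists_subset_card[X2 sX2 cX2] le1 le2.
have sX2X := subset_trans sX2 sX.
rewrite (big_setID X2) [leqRHS](big_setID Y1) /=.
rewrite (setIidPr sX2X) (setIidPr sY).
apply: leq_add; apply: leq_sum_pairwise => //.
- by move=> x y xX yY; apply: le1; [apply: (subsetP sX2) | apply: (subsetP sY)].
- by rewrite !cardsDS // cXY cX2.
- by move=> x y; rewrite inE => /andP[_ xX] yY; apply: le2.
Qed.

Lemma sum_card_mono (e : nat -> nat) (P Q : pred {set E}) :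
  (forall k, #|[set A : {set E} | (#|A| == k) && P A]| <=
     #|[set A : {set E} | (#|A| == k) && Q A]|) ->
  \sum_(A : {set E}) e #|A| * P A <= \sum_(A : {set E}) e #|A| * Q A.
Proof.
move=> lePQ.
have split (P' : pred {set E}) : \sum_(A : {set E}) e #|A| * P' A =
    \sum_(k < #|E|.+1) e k * #|[set A : {set E} | (#|A| == k :> nat) && P' A]|.
  rewrite (partition_big (fun A : {set E} => inord #|A| : 'I_#|E|.+1) predT) //=.
  apply: eq_bigr => k _; rewrite -[X in _ = _ * X]sum1_card big_distrr /=.
  rewrite big_mkcond [RHS]big_mkcond.
  apply: eq_bigr => A _; rewrite inE muln1.
  rewrite -val_eqE /= inordK ?ltnS ?max_card //.
  by case: eqP => [->|_] //=; case: (P' A); rewrite ?muln1 ?muln0.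
by rewrite !split; apply: leq_sum => k _; rewrite leq_mul.
Qed.

End Extensions.

(** * Closure and rank-raising elements *)

Section Raising.
Local Open Scope nat_scope.
Variables (E : finType) (M : matroid E).
Implicit Types A B : {set E}.

(** The complement of the closure of [A]. *)
Definition raising A : {set E} := [set x | rk M A < rk M (x |: A)].

Lemma rk_setU1 A x : rk M A <= rk M (x |: A) <= (rk M A).+1.
Proof.
rewrite rk_mono ?subsetUr //=.
have := rk_submod M [set x] A; have := rk_le_card M [set x].
rewrite cards1; lia.
Qed.

Lemma raising_notin A x : x \in raising A -> x \notin A.
Proof.
by rewrite inE; apply: contraL => xA; rewrite (setUidPr _) ?sub1set // ltnn.
Qed.

Lemma raising_anti A B : A \subset B -> raising B \subset raising A.
Proof.
move=> sAB; apply/subsetP=> x; rewrite !inE => ltB.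
have := rk_submod M (x |: A) B; rewrite -setUA (setUidPr sAB).
have : rk M A <= rk M ((x |: A) :&: B) by rewrite rk_mono // subsetI subsetUr.
lia.
Qed.

(** A maximal set of rank [rk M A] between [A] and its closure is the whole closure: by
    [raising_anti], adjoining a further element of the closure keeps the rank. *)
Lemma rk_closure A : rk M (~: raising A) = rk M A.
Proof.
pose P B := [&& A \subset B, B \subset ~: raising A & rk M B == rk M A].
have PA : P A.
  rewrite /P subxx eqxx andbT /=; apply/subsetP=> x xA.
  by rewrite inE; apply: contraL xA; apply: raising_notin.
have [B /maxsetP[/and3P[sAB sBF /eqP rkB] maxB] _] := maxset_exists PA.
have [<- // | /eqP neqBF] := B =P ~: raising A.
have : B \proper ~: raising A by rewrite properEneq neqBF.
case/properP=> _ [x xF xB].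
suff PxB : P (x |: B) by move: xB; rewrite -(maxB _ PxB) ?subsetUr // setU11.
rewrite /P (subset_trans sAB) ?subsetUr //= subUset sub1set xF sBF /=.
move: xF; rewrite inE => /(contra (subsetP (raising_anti sAB) x)).
rewrite inE -leqNgt rkB => le; rewrite eqn_leq le /=.
by have /andP[+ _] := rk_setU1 B x; rewrite rkB.
Qed.

Lemma flat_closure A : flat M (~: raising A).
Proof.
apply/forallP=> x; apply/implyP; rewrite inE negbK rk_closure => xA.
have sA : A \subset ~: raising A.
  by apply/subsetP=> y yA; rewrite inE; apply: contraL yA; apply: raising_notin.
move: xA; rewrite inE => /leq_trans; apply; exact/rk_mono/setUS.
Qed.

Lemma exists_raising A : rk M A < rank M -> exists x, x \in raising A.
Proof.
move=> ltA; apply/set0Pn; apply: contraTneq ltA => r0.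
by rewrite -rk_closure r0 setC0 ltnn.
Qed.

(* Each element raising [rk A] that is adjoined to [A] leaves the set of raising
   elements, and once [A] spans a hyperplane this set is a cocircuit. *)
Lemma card_raising A :
  (forall C, cocircuit M C -> rank M < #|C|) ->
  rk M A < rank M -> (rank M).*2 <= #|raising A| + rk M A.
Proof.
move=> large; move: {2}(rank M - rk M A) (leqnn (rank M - rk M A)) => k.
elim: k A => [|k IHk] A lek ltA; first by lia.
have [eqA|neqA] := (rk M A).+1 =P rank M.
  have := large (raising A); rewrite /cocircuit /hyperplane flat_closure.
  by rewrite rk_closure eqA eqxx => /(_ isT); lia.
have [x xA] := exists_raising ltA.
have := xA; rewrite inE => ltx; have /andP[_ lex] := rk_setU1 A x.
have /subset_leq_card : raising (x |: A) \subset raising A :\ x.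
  rewrite subsetD1 raising_anti ?subsetUr //=.
  by apply/negP=> /raising_notin; rewrite setU11.
have := IHk (x |: A) ltac:(lia) ltac:(lia).
by rewrite (cardsD1 x (raising A)) xA; lia.
Qed.

(* Induction on [p], matching the elements added to [A] with those added to [B]:
   [R :\: B] has at most as many elements as [raising A] when
   [#|B :&: R| = rk M A]. *)
Lemma leq_card_extensions (R : {set E}) p A B :
  (forall C, cocircuit M C -> rank M < #|C|) ->
  #|R| = (rank M).*2 -> #|A| = #|B| -> #|B :&: R| <= rk M A ->
  #|extensions (fun A' => rk M A' < rank M) A p| <=
  #|extensions (fun B' => #|B' :&: R| < rank M) B p|.
Proof.
move=> large cR; elim: p A B => [|p IHp] A B cAB leBA.
  by rewrite !card_extensions0; case: ltnP => // ltA; rewrite (leq_ltn_trans leBA).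
have [leA|ltA] := leqP (rank M) (rk M A).
  rewrite [X in X <= _](_ : _ = 0) //; apply: eq_card0 => A'; rewrite inE.
  by apply/negP=> /and3P[/(rk_mono M)]; lia.
have cU x y : x \in ~: A -> y \in ~: B -> #|x |: A| = #|y |: B|.
  by rewrite !inE !cardsU1 cAB => -> ->.
have cC : #|~: A| = #|~: B| by rewrite cardsCs [RHS]cardsCs !setCK cAB.
have cI y : #|(y |: B) :&: R| <= #|B :&: R|.+1.
  by rewrite setIUl (leq_trans (leq_card_setU _ _)) // -add1n leq_add2r
    (leq_trans (subset_leq_card (subsetIl _ _))) ?cards1.
rewrite -(leq_pmul2l (ltn0Sn p)) !card_extensionsS.
(* With slack, any [x] may be matched with any [y], since [#|B :&: R|] grows by at most 1. *)
have [ltBA|leAB] := ltnP #|B :&: R| (rk M A).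
  apply: leq_sum_pairwise => // x y xA yB; apply: IHp; first exact: cU.
  by have := cI y; have /andP[] := rk_setU1 A x; lia.
have sXC : raising A \subset ~: A.
  by apply/subsetP=> x xA; rewrite inE raising_notin.
(* Without slack, the elements of [R :\: B] are matched with elements raising [rk M A]; any other
   [y] leaves [B :&: R] unchanged. *)
apply: (leq_sum_pairwise2 sXC (subsetDr R B : R :\: B \subset ~: B)) => //.
- have := card_raising large ltA; have := cardsID B R; rewrite cR setIC; lia.
- move=> x y xA yB; apply: IHp; first exact: cU (subsetP sXC _ xA) yB.
  by move: xA; rewrite inE; have := cI y; lia.
- move=> x y xA; rewrite !inE negb_and negbK => /andP[yR yB].
  apply: IHp; first by apply: cU => //; rewrite inE.
  have {yR} yR : y \notin R by move: yR; rewrite (negbTE yB).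
  suff -> : (y |: B) :&: R = B :&: R by have /andP[] := rk_setU1 A x; lia.
  apply/setP=> z; rewrite !inE; case: eqP => // ->.
  by rewrite (negbTE yR) !andbF.
Qed.

End Raising.

(** * Symmetric difference with a 2r-set *)

Section HalfSets.
Local Open Scope nat_scope.
Variables (E : finType) (r : nat).
Implicit Types A : {set E}.

(* Trading a spanning k-set for a nonspanning one lowers half the sum by 2, but
   only by 1 if k = r, where the spanning sets are bases and contribute 0. *)
Definition nonspanning_weight k := (odd k == odd r) * (2 - (k == r)).

(* The symmetric difference with [R] preserves the parity of [#|A|] and turns
   [#|A :&: R|] into [2r - #|A :&: R|]. *)
Lemma sum_half_sets (R : {set E}) : #|R| = r.*2 ->
  \sum_(A : {set E}) nonspanning_weight #|A| * (#|A :&: R| < r) <=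
  \sum_(A : {set E}) (odd #|A| == odd r) * (#|A| != r).
Proof.
move=> cR; pose f A := (A :\: R) :|: (R :\: A).
have fK : involutive f.
  move=> A; apply/setP=> x; rewrite !inE.
  by case: (x \in A); case: (x \in R).
have cfI A : #|f A :&: R| + #|A :&: R| = r.*2.
  rewrite -cR -(cardsID A R) [A :&: R]setIC addnC; congr (_ + _); apply: eq_card => x.
  by rewrite !inE; case: (x \in A); case: (x \in R).
have cfD A : f A :\: R = A :\: R.
  by apply/setP=> x; rewrite !inE; case: (x \in A); case: (x \in R).
have double F : \sum_(A : {set E}) F A + \sum_(A : {set E}) F A =
    \sum_(A : {set E}) (F A + F (f A)).
  by rewrite big_split [X in _ + X](reindex_inj (inv_inj fK)).
have half m n : m + m <= n + n -> m <= n by lia.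
apply: half; rewrite !double; apply: leq_sum => A _.
have cA := cardsID R A; have := cardsID R (f A); rewrite cfD => cfA.
have := cfI A; rewrite /nonspanning_weight.
have -> : odd #|f A| = odd #|A|.
  have := congr1 odd (cfI A); rewrite -cA -cfA !oddD odd_double.
  by case: (odd #|f A :&: R|); case: (odd #|A :&: R|).
case: (_ == _); rewrite ?mul0n // !mul1n.
(* If one of [A] and [f A] meets [R] in fewer than [r] elements, the other has more than [r]
   elements and so contributes 1 on the right. *)
have [ltA|leA] := ltnP #|A :&: R| r; have [ltfA|lefA] := ltnP #|f A :&: R| r;
  rewrite /= ?muln0 ?muln1 ?addn0 ?add0n // => cI.
- lia.
- have -> : #|f A| != r by lia.
  by case: (#|A| == r).
- have -> : #|A| != r by lia.
  by case: (#|f A| == r).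
Qed.

End HalfSets.

(** * Termwise bound and conclusion *)

Lemma tutte_horner (E : finType) (M : matroid E) (a b : int) :
  (tutte M).[a, b] =
  \sum_(A : {set E}) (a - 1) ^+ (rank M - rk M A) * (b - 1) ^+ (#|A| - rk M A).
Proof.
rewrite /tutte !horner_sum; apply: eq_bigr => A _.
by rewrite !(hornerE, horner_exp).
Qed.

(** Here [s], [c], [j] stand for [rank M], [#|A|], [rk M A]. For [j = s] both sides agree; for
    [j < s] the right side is a sum of two signs, which cancel unless [c] and [s] have the same
    parity. *)
Lemma tutte_term_ge (s c j : nat) : (j <= c)%N -> (j <= s)%N ->
  2 * (((odd c == odd s) * (c != s))%N%:R - (nonspanning_weight s c * (j < s))%N%:R)
  <= (2 - 1) ^+ (s - j) * (0 - 1) ^+ (c - j) + (0 - 1) ^+ (s - j) * (2 - 1) ^+ (c - j)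
     - 2 * ((1 - 1) ^+ (s - j) * (1 - 1) ^+ (c - j)) :> int.
Proof.
move=> jc js; rewrite /nonspanning_weight subrr sub0r (_ : 2 - 1 = 1) // !expr1n.
rewrite mul1r mulr1 !expr0n -signr_odd -[in X in _ + X - _]signr_odd !oddB //.
rewrite !subn_eq0 [(s <= j)%N]leqNgt.
have [-> | ne] := eqVneq c s.
  rewrite eqxx; have [lt|le] := ltnP j s.
    by case: (odd s); case: (odd j).
  have -> : j = s by apply/eqP; rewrite eqn_leq js le.
  by rewrite addbb; case: (odd s).
have [lt|le] /= := ltnP j s.
  by rewrite mul0r; case: (odd s); case: (odd j); case: (odd c).
have -> : j = s by apply/eqP; rewrite eqn_leq js le.
have -> : (c <= s)%N = false by lia.
by rewrite addbb; case: (odd s); case: (odd c).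
Qed.

Theorem theorem3p1 (E : finType) (M : matroid E) (r n : nat)
  (hr : rank M = r) (hn : #|E| = n)
  (hcocircuit : forall C : {set E}, cocircuit M C -> (r.+1 <= #|C|)%N) :
  (tutte M).[2, 0] + (tutte M).[0, 2] >= 2 * (tutte M).[1, 1].
Proof.
move: hcocircuit; rewrite -hr => large.
(* For positive rank, at least [(rank M).*2] elements raise the rank of the empty set. *)
have [R cR] : exists R : {set E}, #|R| = (rank M).*2.
  have [r0|r_gt0] := posnP (rank M); first by exists set0; rewrite r0 cards0.
  have rk0 : rk M set0 = 0%N by have := rk_le_card M set0; rewrite cards0; lia.
  have := card_raising large; move/(_ set0); rewrite rk0 addn0 => /(_ r_gt0).
  by case/exists_subset_card=> R _ cR; exists R.
rewrite -subr_ge0 !tutte_horner mulr_sumr -big_split -sumrB /=.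
apply: le_trans (ler_sum _ (fun A _ => tutte_term_ge (rk_le_card M A)
  (rk_mono M (subsetT A)))).
rewrite -mulr_sumr mulr_ge0 // sumrB -!natr_sum subr_ge0 ler_nat.
apply: leq_trans (sum_half_sets cR).
apply: (@sum_card_mono _ (nonspanning_weight (rank M))
  (fun A => rk M A < rank M)%N (fun A => #|A :&: R| < rank M)%N) => k.
(* The [k]-sets are the extensions of [set0] by [k] elements. *)
have := @leq_card_extensions _ M R k set0 set0 large cR erefl.
rewrite set0I cards0 leq0n => /(_ isT).
rewrite /extensions cards0 add0n.
by congr (_ <= _)%N; apply: eq_card => A; rewrite !inE sub0set.
Qed.
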